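(* Let $q$ be a prime power, let $\alpha,\beta,a,b,c\in\mathbb F_{q^2}$ and $d\in\mathbb F_{q^2}\setminus\mathbb F_q$, and suppose $\alpha=-\beta^q\neq0$. Then \[\frac{\alpha x^{2q}+\beta x^2+ax^q+bx+c}{x^q+x+d}\] is a permutation rational function of $\mathbb F_{q^2}$ if and only if $q=3$, $a^q+b\notin\mathbb F_q$, $\beta^2=(b^2-a^2-\beta c)^2=1$ and $\beta(a-b)-d=0$.
   Context: A rational function $f$ over a finite field $\mathbb F_Q$ is written uniquely as $f=e\,\frac{g}{h}$ with $g,h$ relatively prime monic polynomials over $\mathbb F_Q$ and $e\in\mathbb F_Q^*$. It defines a map on $\mathbb F_Q\cup\{\infty\}$: for $s\in\mathbb F_Q$, $f(s)=e\,g(s)/h(s)$ if $h(s)\neq0$ and $f(s)=\infty$ if $h(s)=0$; moreover $f(\infty)=\infty$ if $\deg g>\deg h$, $f(\infty)=e$ if $\deg g=\deg h$, and $f(\infty)=0$ if $\deg g<\deg h$. If this map is a permutation of $\mathbb F_Q\cup\{\infty\}$, then $f$ is called a permutation rational function of $\mathbb F_Q$. Here $Q=q^2$. (Since $d\notin\mathbb F_q$, the denominator $x^q+x+d$ has no zero in $\mathbb F_{q^2}$.) *)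

(* Defs.v *)
From HB Require Import structures.
From mathcomp Require Import all_boot all_order all_algebra.

Set Implicit Arguments.
Unset Strict Implicit.
Unset Printing Implicit Defensive.

Import GRing.Theory.
Local Open Scope ring_scope.

(* A nonzero f has exactly one such triple (e, g, h). *)
Definition reduced_form (F : fieldType) (f : {fraction {poly F}})
    (e : F) (g h : {poly F}) : Prop :=
  [/\ e != 0, g \is monic, h \is monic, coprimep g h
    & f = tofrac (e *: g) / tofrac h].

(* The map induced on F + {oo} by e * g / h, with None standing for oo.
   Since size p = deg p + 1 for p != 0, comparing sizes of the monic g and h
   compares their degrees. *)
Definition ratmap (F : fieldType) (e : F) (g h : {poly F}) (s : option F) :
    option F :=
  match s with
  | Some x => if h.[x] != 0 then Some (e * g.[x] / h.[x]) else None
  | None =>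
      if (size h < size g)%N then None
      else if size g == size h then Some e
      else Some 0
  end.

Definition permutation_ratfun (F : fieldType) (f : {fraction {poly F}}) : Prop :=
  exists e g h, reduced_form f e g h /\ bijective (ratmap e g h).

(* Main.v *)
Require Import Defs.
From mathcomp Require Import all_boot all_order all_algebra all_field.
From mathcomp Require Import ring zify.

Set Implicit Arguments.
Unset Strict Implicit.
Unset Printing Implicit Defensive.

Import GRing.Theory.
Local Open Scope ring_scope.

(** Write s for the Frobenius x |-> x ^+ q of F, an involution with fixed field
K = F_q.  The denominator s x + x + d has no zero in F, and the numerator has
the larger degree, so oo is sent to oo and cancelling common factors changes
no value: f permutes F + {oo} iff the function phi given by
  phi x = (be x^2 - s be (s x)^2 + a (s x) + b x + c) / (s x + x + d)
is injective on F (permutation_ratfun_rootless).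

Fix e in F outside K and use coordinates x = u + v e, y = A + B e (up to affine
normalization).  Clearing the denominator, phi x = y becomes two equations over
K in (u, v), and phi is injective iff they have exactly one solution for
every (A, B) (injective_uniquely_solvable).  Since be x^2 - s be (s x)^2 has
trace zero, the trace of phi x = y is linear in (u, v).  Let a1 denote the
e-coordinate of a - b.
  - If a1 = 0, then (A, B) can be chosen to make the linear equation
    contradictory.
  - If a1 <> 0, then as (A, B) varies the linear equation describes every line
    v = m u + k (in characteristic 2, u = m v + k) with m, k in K, and the
    other equation restricts to a polynomial of degree at most 2 on that line,
    which must have exactly one root in K.

In characteristic 2 a suitable line makes this quadratic invariant under a
translation by 1, so its roots come in pairs (even_not_uniquely_solvable).

In odd characteristic a quadratic with exactly one root has discriminant zero.
For fixed m this discriminant is itself a polynomial of degree at most 2 in k,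
so its coefficients vanish; as functions of m these coefficients force be in K,
a - b = - 2 be d, and finally m^2 = 1 for every nonzero m, that is
q = 3 (odd_solvable_necessary).  When q = 3 the remaining conditions turn
the quadratic into a multiple of a square if m <> 0, and into a linear
polynomial if m = 0, which gives the converse (odd_solvable_sufficient).  Translating the conditions back to F is
odd_injectiveP. *)

(** * Linear combinations of equations *)

(** These two reduce an equation that follows linearly from others to a ring
identity in which the coefficients of the combination are given. *)
Lemma lincomb1 (R : comPzRingType) (l r c L1 R1 : R) :
  L1 = R1 -> l - r = c * (L1 - R1) -> l = r.
Proof. by move=> -> /eqP; rewrite subrr mulr0 subr_eq0 => /eqP. Qed.

Lemma lincomb2 (R : comPzRingType) (l r c1 c2 L1 R1 L2 R2 : R) :
  L1 = R1 -> L2 = R2 -> l - r = c1 * (L1 - R1) + c2 * (L2 - R2) -> l = r.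
Proof. by move=> -> -> /eqP; rewrite !subrr !mulr0 addr0 subr_eq0 => /eqP. Qed.

(** * Systems of two equations over the subfield *)

(** [A] and [B] are the coordinates of a target, [u] and [v] those of a
preimage. *)
Definition uniquely_solvable (K : Type) (E : K -> K -> K -> K -> Prop) :=
  forall A B,
    exists u v, E A B u v /\
      forall u' v', E A B u' v' -> u' = u /\ v' = v.

(** If [a1 = 0] the second equation, in which only [v] occurs, can be made
contradictory.  Otherwise take [B = a0]: the second equation then fixes [u] and
leaves [v] free, and with [A] as below the first one is, up to a constant,
[b2 * (v ^+ 2 + v)], which is unchanged by [v |-> v + 1]. *)
Lemma even_not_uniquely_solvable (K : fieldType) (t dl b1 b2 a0 a1 c0 c1 : K) :
  2 = 0 :> K -> t != 0 ->
  ~ uniquely_solvable (fun A B u v =>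
      b1 * u ^+ 2 + b2 * v ^+ 2 + a0 * (u + v) + dl * a1 * v + c0
        = A * v + t * dl * B
      /\ a1 * u + a0 * v + c1 = t * (A + B) + B * v).
Proof.
move=> char2 t0 sol.
have [a10|a1n0] := eqVneq a1 0.
  have [u [v [[_ e2] _]]] := sol ((c1 + 1) / t - a0) a0.
  move: e2; rewrite a10 subrK mulrCA divff // mulr1 mul0r add0r => e2.
  case/negP: (oner_neq0 K); apply/eqP.
  by apply: (lincomb1 (c := -1) e2); ring.
set A := a0 + dl * a1 + b2.
have [u [v [[e1 e2] uniq]]] := sol A a0.
have [] := uniq u (v + 1).
  split; last by apply: (lincomb1 (c := 1) e2); ring.
  apply: (lincomb2 (c1 := 1) (c2 := b2 * v) e1 char2); rewrite /A; ring.
move=> _ e; case/negP: (oner_neq0 K); apply/eqP.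
by apply: (lincomb1 (c := 1) e); ring.
Qed.

(** * The system in odd characteristic *)

(** The second root of the quadratic is [- r / p - u]; if it equals [u],
the discriminant is zero. *)
Lemma unique_root_deg2 (K : fieldType) (p r s u : K) :
  p * u ^+ 2 + r * u + s = 0 ->
  (forall u', p * u' ^+ 2 + r * u' + s = 0 -> u' = u) ->
  if p == 0 then r != 0 else r ^+ 2 == 4 * p * s.
Proof.
move=> eu uniq; have [p0|p0] := eqVneq p 0.
  apply/eqP => r0; case/negP: (oner_neq0 K); apply/eqP.
  have e : u + 1 = u.
    by apply: uniq; move: eu; rewrite p0 r0 !mul0r.
  by apply: (lincomb1 (c := 1) e); ring.
have e : - r / p - u = u.
  by apply: uniq; rewrite -[RHS]eu; field.
have {}e : r = - 2 * p * u.
  by apply: (lincomb1 (c := - p) e); field.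
apply/eqP; apply: (lincomb2 (c1 := r + 2 * p * u) (c2 := - 4 * p) e eu).
by ring.
Qed.

Section OddSystem.
Variables (K : fieldType) (dl b0 b1 d0 a0 a1 g c1 : K).

(** The coordinates of [phi x = y] when [e ^+ 2 = dl], [d = 2 * (d0 + e)],
[x = (u - d0) + v * e], [y = b + (A + B * e) / 2], [be = b0 + b1 * e],
[a - b = a0 + a1 * e] and [c = b * d + (a - b) * d0 + e * (c1 + g * e)].  This
makes the denominator [2 * (u + e)] and removes [b] from the system. *)
Definition odd_eqs A B u v :=
  u * A + dl * B = a0 * u - dl * a1 * v + dl * g
  /\ u * B + A =
       2 * (b1 * ((u - d0) ^+ 2 + dl * v ^+ 2) + 2 * b0 * (u - d0) * v)
       + a1 * u - a0 * v + c1.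

(** On the line [v = m * u + k] the second equation becomes a quadratic in [u]
with the coefficients [lead m], [slope m * k + mid m] and [cst m k]. *)
Definition lead m := 2 * b1 * (1 + dl * m ^+ 2) + 4 * b0 * m.
Definition slope m := 4 * b1 * dl * m + 4 * b0 + a1.
Definition mid m := a1 - 4 * b1 * d0 - g - (4 * b0 * d0 + a0) * m.
Definition cst m k :=
  2 * b1 * (d0 ^+ 2 + dl * k ^+ 2) - (4 * b0 * d0 + a0) * k
  + c1 - a0 + dl * a1 * m.

Lemma odd_eqs_line m k u v : dl != 0 -> a1 != 0 ->
  odd_eqs (a0 - dl * a1 * m) (g - a1 * k) u v <->
  v = m * u + k /\ lead m * u ^+ 2 + (slope m * k + mid m) * u + cst m k = 0.
Proof.
move=> dl0 a10; rewrite /odd_eqs /lead /slope /mid /cst; split.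
  case=> e1 e2.
  have ev : v = m * u + k.
    have nz : dl * a1 != 0 by rewrite mulf_neq0.
    by apply: (mulfI nz); apply: (lincomb1 (c := 1) e1); ring.
  split=> //; subst v.
  apply: (lincomb1 (c := -1) e2); ring.
case=> -> e; split; first ring.
by apply: (lincomb1 (c := -1) e); ring.
Qed.

(** If [a1 = 0], the first equation cannot hold for [A = a0] and [B != g]. *)
Lemma odd_solvable_a1 : uniquely_solvable odd_eqs -> dl != 0 -> a1 != 0.
Proof.
move=> sol dl0; apply/eqP => a10.
have [u [v [[e _] _]]] := sol a0 (g + 1).
case/negP: dl0; apply/eqP; move: e; rewrite a10 => e.
by apply: (lincomb1 (c := 1) e); ring.
Qed.

Hypotheses (two_neq0 : 2 != 0 :> K) (dl_neq0 : dl != 0).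

Lemma odd_solvable_discriminant : uniquely_solvable odd_eqs -> forall m k,
  if lead m == 0 then slope m * k + mid m != 0
  else (slope m * k + mid m) ^+ 2 == 4 * lead m * cst m k.
Proof.
move=> sol m k; have a10 := odd_solvable_a1 sol dl_neq0.
have [u [v [/(odd_eqs_line _ _ _ _ dl_neq0 a10) [_ e] uniq]]] :=
  sol (a0 - dl * a1 * m) (g - a1 * k).
apply: (unique_root_deg2 e) => u' e'.
by have [] := uniq u' (m * u' + k);
  first exact/(odd_eqs_line _ _ _ _ dl_neq0 a10).
Qed.

(** For [lead m != 0] this says that the coefficient of [k ^+ 2] in the
discriminant is zero.  It persists for [lead m = 0]: a nonzero [slope m] would
give some [k] for which the coefficient of [u] vanishes too. *)
Lemma slope_sq : uniquely_solvable odd_eqs -> forall m,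
  slope m ^+ 2 = 8 * b1 * dl * lead m.
Proof.
move=> sol m; have disc := odd_solvable_discriminant sol m.
have [p0|p0] := eqVneq (lead m) 0.
  suff -> : slope m = 0 by rewrite p0; ring.
  apply/eqP; apply: contraT => s0.
  have := disc (- mid m / slope m); rewrite p0 eqxx.
  by rewrite mulrCA divff // mulr1 addNr eqxx.
have {}disc k : (slope m * k + mid m) ^+ 2 = 4 * lead m * cst m k.
  by apply/eqP; move: (disc k); rewrite (negPf p0).
(* The second difference of a quadratic polynomial in k at -1, 0, 1 is twice its
   leading coefficient. *)
apply: (mulfI two_neq0).
have e : (slope m * 1 + mid m) ^+ 2 + (slope m * -1 + mid m) ^+ 2
    - 2 * (slope m * 0 + mid m) ^+ 2 = 2 * slope m ^+ 2 by ring.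
by rewrite -e !disc /cst; ring.
Qed.

(** In [slope_sq] the terms in [m ^+ 2] cancel, and both sides differ by an
affine function of [m] with leading coefficient [8 * b1 * dl * a1] and, once
[b1 = 0], constant term [(4 * b0 + a1) ^+ 2]. *)
Lemma odd_solvable_b1 : uniquely_solvable odd_eqs -> b1 = 0 /\ a1 = - 4 * b0.
Proof.
move=> sol; have a10 := odd_solvable_a1 sol dl_neq0.
have e0 := slope_sq sol 0; have e1 := slope_sq sol 1.
rewrite /slope /lead in e0 e1.
have b10 : b1 = 0.
  have nz : 2 * 2 * 2 * dl * a1 != 0 by rewrite !mulf_neq0.
  apply: (mulfI nz); apply: (lincomb2 (c1 := 1) (c2 := -1) e1 e0); ring.
split=> //; move: e0; rewrite b10 => e0.
have e : (a1 + 4 * b0) ^+ 2 = 0 by apply: (lincomb1 (c := 1) e0); ring.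
have /eqP {}e : a1 + 4 * b0 == 0 by rewrite -sqrf_eq0 e.
by apply: (lincomb1 (c := 1) e); ring.
Qed.

(** With [b1 = 0] and [a1 = - 4 * b0] the slope vanishes identically, so the
discriminant is affine in [k]; its [k] term gives [a0], and comparing [m = 1]
with [m = -1] gives [c1].  What is left is
[(4 * b0 + g) ^+ 2 = - 64 * b0 ^+ 2 * dl * m ^+ 2] for every [m != 0], so that
[m ^+ 2] takes on nonzero [m] only its value at [m = 1]. *)
Lemma odd_solvable_necessary : uniquely_solvable odd_eqs ->
  [/\ forall m : K, m != 0 -> m ^+ 2 = 1, b1 = 0, b0 != 0, a1 = - 4 * b0
    & [/\ a0 = - 4 * b0 * d0, c1 = a0, dl = -1 & 4 * b0 + g != 0]].
Proof.
move=> sol; have a10 := odd_solvable_a1 sol dl_neq0.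
have [b10 a1E] := odd_solvable_b1 sol.
have b00 : b0 != 0.
  by apply: contraNneq a10 => b00; rewrite a1E b00 mulr0.
have disc m k : m != 0 -> (mid m) ^+ 2 = 16 * b0 * m * cst m k.
  move=> m0; have := odd_solvable_discriminant sol m k.
  rewrite ifN; last first.
    rewrite /lead b10 mulr0 mul0r add0r !mulf_neq0 //.
    by have -> : 4 = 2 * 2 :> K by [ring]; rewrite mulf_neq0.
  by rewrite /slope /lead a1E b10 => /eqP e; apply: (lincomb1 (c := 1) e); ring.
have nz : 2 * 2 * 2 * 2 * b0 != 0 by rewrite !mulf_neq0.
have a0E : a0 = - 4 * b0 * d0.
  have e0 := disc 1 0 (oner_neq0 _); have e1 := disc 1 1 (oner_neq0 _).
  apply: (mulfI nz); apply: (lincomb2 (c1 := -1) (c2 := 1) e0 e1).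
  by rewrite /cst b10; ring.
have N1 : -1 != 0 :> K by rewrite oppr_eq0 oner_neq0.
have c1E : c1 = a0.
  have e0 := disc 1 0 (oner_neq0 _); have e1 := disc (-1) 0 N1.
  apply: (mulfI nz); apply: (mulfI two_neq0).
  apply: (lincomb2 (c1 := -1) (c2 := 1) e0 e1).
  by rewrite /cst /mid b10 a0E; ring.
have main m : m != 0 -> (4 * b0 + g) ^+ 2 = - 64 * b0 ^+ 2 * dl * m ^+ 2.
  move=> m0; have e := disc m 0 m0.
  by apply: (lincomb1 (c := 1) e); rewrite /cst /mid b10 a0E c1E a1E a0E; ring.
have sq1 (m : K) : m != 0 -> m ^+ 2 = 1.
  move=> m0.
  have nz' : (2 * 2 * 2 * b0) ^+ 2 * dl != 0.
    by rewrite mulf_neq0 // sqrf_eq0 !mulf_neq0.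
  apply: (mulfI nz').
  apply: (lincomb2 (c1 := -1) (c2 := 1) (main 1 (oner_neq0 _)) (main m m0)).
  ring.
have hE : (4 * b0 + g) ^+ 2 = - dl.
  (* Since 2 ^+ 2 = 1 the characteristic is 3, and -64 = -1 there. *)
  rewrite (main 1) ?oner_neq0 // (sq1 b0) //.
  by apply: (lincomb1 (c := - 21 * dl) (sq1 _ two_neq0)); ring.
have h0 : 4 * b0 + g != 0 by rewrite -sqrf_eq0 hE oppr_eq0.
by split=> //; split=> //; rewrite -[dl]opprK -hE sq1.
Qed.
End OddSystem.

(** With [h = 4 * b0 + g] the quadratic on [v = m * u + k] is
[b0 * m * u ^+ 2 - h * u + b0 * m].  It has the root [- h * b0 * m] only: if
[m != 0] it is [b0 * m * (u + h * b0 * m) ^+ 2], because all nonzero squares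
are 1 and [3 = 0]. *)
Lemma odd_solvable_sufficient (K : fieldType) (dl b0 b1 d0 a0 a1 g c1 : K) :
  2 != 0 :> K ->
  [/\ forall m : K, m != 0 -> m ^+ 2 = 1, b1 = 0, b0 != 0, a1 = - 4 * b0
    & [/\ a0 = - 4 * b0 * d0, c1 = a0, dl = -1 & 4 * b0 + g != 0]] ->
  uniquely_solvable (odd_eqs dl b0 b1 d0 a0 a1 g c1).
Proof.
move=> two_neq0 [sq1 -> b00 a1E [a0E -> dlE h0]] A B.
have three0 : 3 = 0 :> K.
  by apply: (lincomb1 (c := 1) (sq1 _ two_neq0)); ring.
have a10 : a1 != 0.
  rewrite a1E mulf_neq0 // oppr_eq0.
  by have -> : 4 = 2 * 2 :> K by [ring]; rewrite mulf_neq0.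
have dl0 : dl != 0 by rewrite dlE oppr_eq0 oner_neq0.
have -> : A = a0 - dl * a1 * ((a0 - A) / (dl * a1)).
  by field; rewrite a10.
have -> : B = g - a1 * ((g - B) / a1) by field.
set m := _ / _; set k := _ / _.
set h := 4 * b0 + g in h0.
have eqs u v :
    odd_eqs dl b0 0 d0 a0 a1 g a0 (a0 - dl * a1 * m) (g - a1 * k) u v <->
    v = m * u + k /\ u = - h * b0 * m.
  rewrite odd_eqs_line //; split=> -[-> e]; split=> //.
    have hh := sq1 _ h0; have bb := sq1 _ b00.
    have {}e : b0 * m * u ^+ 2 - h * u + b0 * m = 0.
      apply: (lincomb2 (c1 := 1) (c2 := - b0 * m * (u ^+ 2 + 1)) e three0).
      by rewrite /lead /slope /mid /cst a0E a1E dlE /h; ring.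
    have [m0|m0] := eqVneq m 0.
      by apply: (mulfI h0); apply: (lincomb1 (c := -1) e); rewrite m0; ring.
    have mm := sq1 _ m0.
    have /eqP : (u + h * b0 * m) ^+ 2 = 0.
      transitivity (b0 * m * (b0 * m * u ^+ 2 - h * u + b0 * m)
          + 3 * (h * b0 * m * u) + (h ^+ 2 - 1)
          + (b0 ^+ 2 * m ^+ 2 - 1) * (h ^+ 2 - 1 - u ^+ 2)).
        ring.
      by rewrite e three0 hh bb mm; ring.
    rewrite sqrf_eq0 => /eqP {}e; apply: (lincomb1 (c := 1) e); ring.
  have hh := sq1 _ h0; have bb := sq1 _ b00.
  have [m0|m0] := eqVneq m 0.
    by rewrite e /lead /slope /mid /cst a0E a1E dlE m0; ring.
  have mm := sq1 _ m0.
  transitivity (b0 * m * (4 * h ^+ 2 * b0 ^+2 * m ^+ 2 + h ^+ 2 + 4)).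
    by rewrite e /lead /slope /mid /cst a0E a1E dlE /h; ring.
  rewrite hh bb mm; apply: (lincomb1 (c := 3 * b0 * m) three0); ring.
exists (- h * b0 * m), (m * (- h * b0 * m) + k); split; first exact/eqs.
by move=> u v /eqs [-> ->].
Qed.

(** * Coordinates on the quadratic extension *)

Section Coordinates.
Variables (K F : finFieldType).
Variables (iota : {rmorphism K -> F}) (s : {rmorphism F -> F}).
Hypothesis (cardF : #|F| = (#|K| ^ 2)%N).
Hypotheses (s_iota : forall u, s (iota u) = iota u)
  (fix_s : forall x, s x = x -> exists u, x = iota u)
  (sK : forall x, s (s x) = x).

Lemma trace_in_subfield x : exists u, s x + x = iota u.
Proof. by apply: fix_s; rewrite rmorphD sK addrC. Qed.

Definition coord_bij (X : K -> K -> F) :=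
  bijective (fun p : K * K => X p.1 p.2).

Lemma basis_bij e : e \notin codom iota ->
  coord_bij (fun u v => iota u + iota v * e).
Proof.
move=> eK; apply: inj_card_bij; last by rewrite card_prod cardF.
move=> [u v] [u' v'] /= h.
have [vv|vv] := eqVneq v v'.
  by move: h; rewrite vv => /addIr /fmorph_inj ->.
case/negP: eK; apply/codomP; exists ((u' - u) / (v - v')).
have vv0 : iota v - iota v' != 0 by rewrite -rmorphB fmorph_eq0 subr_eq0.
apply: (mulfI vv0); rewrite fmorph_div !rmorphB mulrCA divff // mulr1.
by apply: (lincomb1 (c := 1) h); ring.
Qed.

Lemma basis_eq0 e u v : e \notin codom iota ->
  iota u + iota v * e = 0 <-> u = 0 /\ v = 0.
Proof.
move=> /basis_bij /bij_inj inj; split=> [h|[-> ->]]; last first.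
  by rewrite rmorph0 mul0r addr0.
by have [] : (u, v) = (0, 0) by apply: inj; rewrite /= h rmorph0 mul0r addr0.
Qed.

(** An injective self-map of a finite set is bijective, which turns injectivity
into existence and uniqueness of preimages. *)
Lemma injective_uniquely_solvable X Y phi E :
  coord_bij X -> coord_bij Y ->
  (forall A B u v, phi (X u v) = Y A B <-> E A B u v) ->
  injective phi <-> uniquely_solvable E.
Proof.
move=> [X' XK X'K] [Y' YK Y'K] h; split.
  move=> inj A B; have [psi phiK psiK] := injF_bij inj.
  have [u [v e]] : exists u v, phi (X u v) = Y A B.
    exists (X' (psi (Y A B))).1, (X' (psi (Y A B))).2.
    by rewrite X'K psiK.
  exists u, v; split; first exact/h.
  move=> u' v' /h; rewrite -e => /inj e'.
  by have := XK (u', v'); rewrite /= e' (XK (u, v)) => -[].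
move=> sol x x' e; rewrite -(X'K x) -(X'K x').
case: (X' x) (X' x') (X'K x) (X'K x') => u v [u' v'] /= ex ex'.
have [u0 [v0 [_ uniq]]] := sol (Y' (phi x)).1 (Y' (phi x)).2.
have [|-> ->] := uniq u v; first by apply/h; rewrite Y'K ex.
by have [|-> ->] := uniq u' v'; first by apply/h; rewrite Y'K ex'.
Qed.

Variables (be a b c d : F).
Hypothesis (dK : d \notin codom iota).

Definition phi x :=
  (be * x ^+ 2 - s be * s x ^+ 2 + a * s x + b * x + c) / (s x + x + d).

(** Otherwise [- d] would be the trace of [x]. *)
Lemma den_neq0 x : s x + x + d != 0.
Proof.
apply: contra dK => /eqP e.
have [u eu] := trace_in_subfield x.
apply/codomP; exists (- u); rewrite rmorphN -eu.
by apply: (lincomb1 (c := 1) e); ring.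
Qed.

Lemma phi_eq x y : phi x = y <->
  be * x ^+ 2 - s be * s x ^+ 2 + a * s x + b * x + c - y * (s x + x + d) = 0.
Proof.
by rewrite /phi; split=> [<-|/eqP]; [rewrite divfK ?den_neq0 // subrr |
  rewrite subr_eq0 => /eqP ->; rewrite mulfK ?den_neq0].
Qed.

(** * The two characteristics *)

(** Coordinates in characteristic 2: with [t = s d + d] and [e = d / t] one has
[s e = 1 + e], so that [u + v * e] has trace [v]. *)
Lemma even_not_injective : 2 = 0 :> K -> ~ injective phi.
Proof.
move=> char2.
have char2F : 2 = 0 :> F by rewrite -(rmorph_nat iota 2) char2 rmorph0.
have [t et] := trace_in_subfield d.
have t0 : iota t != 0.
  apply: contra dK => /eqP t0; move: et; rewrite t0 => et.
  have [|u ->] := @fix_s d; last exact: codom_f.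
  by apply: (lincomb2 (c1 := 1) (c2 := - d) et char2F); ring.
set e := d / iota t.
have dE : d = iota t * e by rewrite /e mulrCA divff // mulr1.
have se : s e = 1 + e.
  rewrite /e fmorph_div /= s_iota.
  apply: (mulfI t0).
  rewrite mulrCA divff // mulr1 mulrDr mulrCA divff // !mulr1.
  by apply: (lincomb2 (c1 := 1) (c2 := - d) et char2F); ring.
have eK : e \notin codom iota.
  apply: contra dK => /codomP [u eu].
  by rewrite dE eu -rmorphM; apply: codom_f.
clearbody e.
have [dl edl] : exists dl, e ^+ 2 - e = iota dl.
  apply: fix_s; rewrite rmorphB rmorphXn /= se.
  by apply: (lincomb1 (c := e) char2F); ring.
have [b1 eb1] := trace_in_subfield be.
have [b2 eb2] := trace_in_subfield (be * e ^+ 2).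
have be_bij := basis_bij eK; have [ci _ ciK] := be_bij.
have := ciK (a - b); case: (ci (a - b)) => a0 a1 /= ea.
have := ciK (c - b * d); case: (ci (c - b * d)) => c0 c1 /= ec.
have Y_bij : coord_bij (fun A B => b + (iota A + iota B * e)).
  case: be_bij => f fK Kf; exists (fun y => f (y - b)) => [p|y] /=.
    by rewrite addrC addKr fK.
  by rewrite Kf addrC subrK.
have eqs A B u v : phi (iota u + iota v * e) = b + (iota A + iota B * e) <->
    b1 * u ^+ 2 + b2 * v ^+ 2 + a0 * (u + v) + dl * a1 * v + c0
        = A * v + t * dl * B
      /\ a1 * u + a0 * v + c1 = t * (A + B) + B * v.
  rewrite phi_eq; set x := iota u + _.
  set y := b + _.
  have ee : e ^+ 2 = e + iota dl by rewrite -edl addrC subrK.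
  have sx : s x = iota u + iota v * (1 + e).
    by rewrite /x rmorphD rmorphM !s_iota se.
  have -> : be * x ^+ 2 - s be * s x ^+ 2 + a * s x + b * x + c
      - y * (s x + x + d)
    = iota (b1 * u ^+ 2 + b2 * v ^+ 2 + a0 * (u + v) + dl * a1 * v + c0
            - (A * v + t * dl * B))
     + iota (a1 * u + a0 * v + c1 - (t * (A + B) + B * v)) * e.
    (* The two sides agree modulo 2 and e ^+ 2 = e + dl; the cofactor collects
       the doubled terms. *)
    apply: (lincomb1 (c := - s be * s x ^+ 2
      + iota u * iota v * (be * e + s be * (1 + e)) + iota a1 * iota v * e
      - (iota A + iota B * e) * (iota u + iota v * e)) char2F).
    have -> : a = b + (iota a0 + iota a1 * e) by rewrite ea addrC subrK.
    have -> : c = b * d + (iota c0 + iota c1 * e) by rewrite ec addrC subrK.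
    rewrite sx {sx} dE /x /y !(rmorphD, rmorphN, rmorphM, rmorphXn) /=.
    rewrite -eb1 -eb2 rmorphM rmorphXn /= se.
    ring: ee.
  rewrite (basis_eq0 _ _ eK); split=> -[/eqP + /eqP +];
    by rewrite ?subr_eq0 => /eqP-> /eqP->; rewrite ?subrr.
move=> /(injective_uniquely_solvable be_bij Y_bij eqs).
apply: even_not_uniquely_solvable => //.
by apply: contraNneq t0 => ->; rewrite rmorph0.
Qed.

(** Coordinates in odd characteristic: [e] is the trace-zero part of [d / 2], so
that [s e = - e] and [e ^+ 2] lies in the subfield.  The conditions on the
coordinates match those on the coefficients because, once [be ^+ 2 = 1] and
[a - b = be * d], the element [b ^+ 2 - a ^+ 2 - be * c] has the coordinates
computed in [key] below: as the subfield is [{0, 1, -1}], it is [1] or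
[-1] iff its [e]-coordinate vanishes and its other coordinate does not. *)
Lemma odd_injectiveP : 2 != 0 :> K -> injective phi <->
  [/\ forall m : K, m != 0 -> m ^+ 2 = 1, s a + b \notin codom iota,
    be ^+ 2 = 1 /\ (b ^+ 2 - a ^+ 2 - be * c) ^+ 2 = 1 & be * (a - b) - d = 0].
Proof.
move=> two_neq0.
have twoF : 2 != 0 :> F by rewrite -(rmorph_nat iota 2) fmorph_eq0.
have fourF : 4 != 0 :> F.
  by have -> : 4 = 2 * 2 :> F by [ring]; rewrite mulf_neq0.
have [t et] := trace_in_subfield d.
set d0 := t / 4; set e := d / 2 - iota d0.
have dE : d = 2 * (iota d0 + e) by rewrite /e; field.
have se : s e = - e.
  rewrite /e rmorphB s_iota fmorph_div rmorph_nat /d0 fmorph_div rmorph_nat -et.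
  by field; rewrite fourF.
clearbody e d0.
have eK : e \notin codom iota.
  apply: contra dK => /codomP [u eu].
  by rewrite dE eu -rmorphD -(rmorph_nat iota) -rmorphM; apply: codom_f.
have e0 : e != 0.
  by apply: contraNneq eK => ->; rewrite -(rmorph0 iota); apply: codom_f.
have [dl ee] : exists dl, e ^+ 2 = iota dl.
  by apply: fix_s; rewrite rmorphXn /= se sqrrN.
have dl0 : dl != 0 by rewrite -(fmorph_eq0 iota) -ee sqrf_eq0.
have be_bij := basis_bij eK; have [ci ciK' ciK] := be_bij.
have := ciK be; case: (ci be) => b0 b1 /= ebe.
have := ciK (a - b); case: (ci (a - b)) => a0 a1 /= ea.
have := ciK ((c - b * d - (a - b) * iota d0) / e).
case: (ci _) => c1 g /= ec.
have {ec} ec : c = b * d + (a - b) * iota d0 + e * (iota c1 + iota g * e).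
  by rewrite ec; field.
have X_bij : coord_bij (fun u v => iota (u - d0) + iota v * e).
  exists (fun y => ((ci y).1 + d0, (ci y).2)) => [[u v]|y] /=.
    by rewrite (ciK' (u - d0, v)) /= subrK.
  by rewrite addrK ciK.
have Y_bij : coord_bij (fun A B => b + (iota A + iota B * e) / 2).
  exists (fun y => ci ((y - b) * 2)) => [p|y] /=.
    by rewrite addrC addKr divfK // ciK'.
  by rewrite ciK mulfK // addrC subrK.
have eqs A B u v :
    phi (iota (u - d0) + iota v * e) = b + (iota A + iota B * e) / 2 <->
    odd_eqs dl b0 b1 d0 a0 a1 g c1 A B u v.
  rewrite phi_eq; set x := iota _ + _; set y := b + _.
  have sx : s x = iota (u - d0) - iota v * e.
    by rewrite /x rmorphD rmorphM !s_iota se mulrN.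
  have sbe : s be = iota b0 - iota b1 * e.
    by rewrite -ebe rmorphD rmorphM !s_iota se mulrN.
  have -> : be * x ^+ 2 - s be * s x ^+ 2 + a * s x + b * x + c
      - y * (s x + x + d)
    = iota (a0 * u - dl * a1 * v + dl * g - (u * A + dl * B))
     + iota (2 * (b1 * ((u - d0) ^+ 2 + dl * v ^+ 2) + 2 * b0 * (u - d0) * v)
                 + a1 * u - a0 * v + c1 - (u * B + A)) * e.
    have aE : a = b + (iota a0 + iota a1 * e) by rewrite ea addrC subrK.
    rewrite sx {sx} sbe -ebe ec aE dE /x /y.
    rewrite !(rmorphD, rmorphN, rmorphM, rmorphXn, rmorph_nat) /= -ee.
    by field.
  rewrite (basis_eq0 _ _ eK) /odd_eqs; split=> -[/eqP + /eqP +];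
    by rewrite ?subr_eq0 => /eqP-> /eqP->; rewrite ?subrr.
rewrite (injective_uniquely_solvable X_bij Y_bij eqs).
have key : 3 = 0 :> K -> b0 ^+ 2 = 1 -> be = iota b0 -> a - b = be * d ->
    dl = -1 -> b ^+ 2 - a ^+ 2 - be * c
    = iota (b0 * (4 * b0 + g)) + iota (- (d0 + b0 * c1)) * e.
  move=> three0 bb beE abE dlE.
  have three0F : 3 = 0 :> F by rewrite -(rmorph_nat iota 3) three0 rmorph0.
  have aE : a = b + be * d by rewrite -abE addrC subrK.
  have bbF : iota b0 ^+ 2 = 1 by rewrite -rmorphXn bb rmorph1.
  have eeF : e ^+ 2 = -1 by rewrite ee dlE rmorphN1.
  apply: (lincomb1 (c := - (b * iota b0 * d + 2 * iota d0 ^+ 2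
    + 3 * iota d0 * e)) three0F).
  rewrite ec aE beE dE !(rmorphD, rmorphN, rmorphM, rmorph_nat) /=.
  ring: bbF eeF.
have coord_inj u v u' v' :
    iota u + iota v * e = iota u' + iota v' * e -> u = u' /\ v = v'.
  by move=> h; have := ciK' (u, v); rewrite /= h (ciK' (u', v')) => -[].
have three0_of : (forall m : K, m != 0 -> m ^+ 2 = 1) -> 3 = 0 :> K.
  by move=> sq1; apply: (lincomb1 (c := 1) (sq1 _ two_neq0)); ring.
split=> [sol|[sq1 _ [be2 cond2] cond3]].
  have [sq1 b10 b00 a1E [a0E c1E dlE h0]] :=
    odd_solvable_necessary two_neq0 dl0 sol.
  have three0 := three0_of sq1.
  have three0F : 3 = 0 :> F by rewrite -(rmorph_nat iota 3) three0 rmorph0.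
  have bb := sq1 _ b00.
  have beE : be = iota b0 by rewrite -ebe b10 rmorph0 mul0r addr0.
  have abE : a - b = be * d.
    apply: (lincomb1 (c := - 2 * iota b0 * (iota d0 + e)) three0F).
    rewrite -ea a0E a1E beE dE !(rmorphM, rmorphN, rmorph_nat) /=; ring.
  have be2 : be ^+ 2 = 1 by rewrite beE -rmorphXn bb rmorph1.
  split=> //.
  - (* If s fixed s a + b, it would fix a - b = be * d, and with it d;
       but d - s d = 4 * e. *)
    apply/negP => /codomP [u eu].
    have eu' : a + s b = s a + b.
      by rewrite [RHS]eu -(s_iota u) -eu rmorphD sK.
    have e1 : be * (d - s d) = 0.
      have -> : be * (d - s d) = (a - b) - s (a - b).
        by rewrite abE rmorphM [s be](_ : _ = be) ?beE ?s_iota // mulrBr.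
      rewrite rmorphB; apply: (lincomb1 (c := 1) eu'); ring.
    have e2 : 4 * (be * e) = 0.
      by rewrite -e1 dE rmorphM rmorphD rmorph_nat s_iota se; ring.
    move/eqP: e2; rewrite !mulf_eq0 (negPf fourF) (negPf e0) beE fmorph_eq0.
    by rewrite (negPf b00).
  - split=> //; rewrite key //.
    have -> : d0 + b0 * c1 = 0.
      rewrite c1E a0E.
      by apply: (lincomb2 (c1 := - 4 * d0) (c2 := - d0) bb three0); ring.
    rewrite oppr0 rmorph0 mul0r addr0 -rmorphXn sq1 ?rmorph1 //.
    by rewrite mulf_neq0.
  - by rewrite abE mulrA -expr2 be2 mul1r subrr.
apply: odd_solvable_sufficient => //.
have three0 := three0_of sq1.
have three0F : 3 = 0 :> F by rewrite -(rmorph_nat iota 3) three0 rmorph0.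
have [b0E b10] : b0 ^+ 2 = 1 /\ b1 = 0.
  have [w ww beE] : exists2 w, w ^+ 2 = 1 & be = iota w.
    have /eqP := be2; rewrite sqrf_eq1 => /orP [] /eqP ->.
      by exists 1; rewrite ?expr1n ?rmorph1.
    by exists (-1); rewrite ?sqrrN ?expr1n ?rmorphN1.
  have [|-> ->] := coord_inj b0 b1 w 0; last by [].
  by rewrite ebe beE rmorph0 mul0r addr0.
have b00 : b0 != 0 by rewrite -sqrf_eq0 b0E oner_neq0.
have beE : be = iota b0 by rewrite -ebe b10 rmorph0 mul0r addr0.
have abE : a - b = be * d.
  by apply: (lincomb2 (c1 := - (a - b)) (c2 := be) be2 cond3); ring.
have [a0E a1E] : a0 = - 4 * b0 * d0 /\ a1 = - 4 * b0.
  apply: coord_inj; rewrite ea abE beE dE.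
  apply: (lincomb1 (c := 2 * iota b0 * (iota d0 + e)) three0F).
  rewrite !(rmorphM, rmorphN, rmorph_nat) /=; ring.
(* The other square root of 1, dl = 1, would put e into K. *)
have dlE : dl = -1.
  have /eqP := sq1 _ dl0; rewrite sqrf_eq1 => /orP [] /eqP // dl1.
  case/negP: eK; move/eqP: ee; rewrite dl1 rmorph1 sqrf_eq1 => /orP [] /eqP ->.
    by rewrite -(rmorph1 iota) codom_f.
  by rewrite -(rmorphN1 iota) codom_f.
have cond2E := key three0 b0E beE abE dlE.
have [w [w0 wE]] : exists w, w != 0 /\ b ^+ 2 - a ^+ 2 - be * c = iota w.
  move/eqP: cond2; rewrite sqrf_eq1 => /orP [] /eqP ->.
    by exists 1; rewrite rmorph1 oner_neq0.
  by exists (-1); rewrite rmorphN1 oppr_eq0 oner_neq0.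
have [hw c1w] : b0 * (4 * b0 + g) = w /\ - (d0 + b0 * c1) = 0.
  by apply: coord_inj; rewrite -cond2E wE rmorph0 mul0r addr0.
split=> //; split=> //.
  rewrite a0E; apply: (mulfI b00).
  have -> : - 4 * b0 * d0 = - b0 * d0.
    by apply: (lincomb1 (c := - b0 * d0) three0); ring.
  by apply: (lincomb2 (c1 := -1) (c2 := d0) c1w b0E); ring.
by apply: contraNneq w0 => h0; rewrite -hw h0 mulr0.
Qed.
End Coordinates.

(** * Rational functions without finite poles *)

Lemma exists_reduced_form (F : fieldType) (N D : {poly F}) : N != 0 -> D != 0 ->
  exists e g h, reduced_form (tofrac N / tofrac D) e g h.
Proof.
move=> N0 D0; set G := gcdp N D.
have G0 : G != 0 by rewrite gcdp_eq0 negb_and N0.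
have := coprimep_div_gcd (p := N) (q := D); rewrite N0 => /(_ isT).
have := divpK (dvdp_gcdl N D); have := divpK (dvdp_gcdr N D).
rewrite -/G; set D1 := D %/ G; set N1 := N %/ G => DE NE co.
have N10 : N1 != 0 by apply: contraNneq N0 => N10; rewrite -NE N10 mul0r.
have D10 : D1 != 0 by apply: contraNneq D0 => D10; rewrite -DE D10 mul0r.
have l0 := N10; have m0 := D10; rewrite -!lead_coef_eq0 in l0 m0.
exists (lead_coef N1 / lead_coef D1), ((lead_coef N1)^-1 *: N1),
  ((lead_coef D1)^-1 *: D1).
split.
- by rewrite mulf_neq0 ?invr_eq0.
- by rewrite monicE lead_coefZ mulVf.
- by rewrite monicE lead_coefZ mulVf.
- by rewrite coprimepZl ?coprimepZr ?invr_eq0.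
- apply/eqP; rewrite eqr_div ?tofrac_eq0 ?scaler_eq0 ?invr_eq0 ?negb_or ?m0 //.
  rewrite -!tofracM tofrac_eq; apply/eqP; rewrite -{1}NE -{1}DE -!mul_polyC.
  have lC (P : {poly F}) : P != 0 -> (lead_coef P)%:P * (lead_coef P)^-1%:P = 1.
    by move=> P0; rewrite -polyCM divff ?lead_coef_eq0.
  rewrite polyCM.
  transitivity (N1 * D1 * G * (lead_coef D1)^-1%:P * 1); first by ring.
  by rewrite -(lC _ N10); ring.
Qed.

(** In any reduced form [e * g / h], [h] divides [D] and hence has no roots, and
[deg g - deg h = deg N - deg D]; so the induced map fixes oo and is [N / D] at
the finite points. *)
Lemma permutation_ratfun_rootless (F : finFieldType) (N D : {poly F}) :
  (size D < size N)%N -> (forall x, D.[x] != 0) ->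
  permutation_ratfun (tofrac N / tofrac D) <->
  injective (fun x => N.[x] / D.[x]).
Proof.
move=> ltDN D0.
have D_neq0 : D != 0 by apply: contraTneq (D0 0) => ->; rewrite horner0 eqxx.
have N_neq0 : N != 0 by rewrite -size_poly_gt0 (leq_ltn_trans _ ltDN).
have ratmapE e g h : reduced_form (tofrac N / tofrac D) e g h ->
    ratmap e g h =1 omap (fun x => N.[x] / D.[x]).
  case=> e0 g_mon h_mon co /eqP.
  have g0 := monic_neq0 g_mon; have h0 := monic_neq0 h_mon.
  rewrite eqr_div ?tofrac_eq0 // -!tofracM tofrac_eq => /eqP eq.
  have hD : h %| D.
    have : h %| e *: g * D by rewrite -eq dvdp_mull.
    by rewrite -scalerAl dvdpZr // Gauss_dvdpr // coprimep_sym.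
  have hx x : h.[x] != 0.
    apply: contraNneq (D0 x) => hx.
    by have /dvdpP [w ->] := hD; rewrite hornerM hx mulr0.
  have lthg : (size h < size g)%N.
    have := congr1 (fun p : {poly F} => size p) eq.
    rewrite /= -scalerAl size_scale // !size_mul //.
    move: ltDN; rewrite -(size_poly_gt0 h) -(size_poly_gt0 g) in h0 g0 *.
    move: (size g) (size h) (size D) (size N) h0 g0 => *; lia.
  case=> [x|] /=; last by rewrite lthg.
  rewrite hx; congr Some; apply/eqP.
  rewrite eqr_div //; apply/eqP.
  by have := congr1 (fun p => p.[x]) eq; rewrite /= !hornerE => <-.
split=> [[e [g [h [red /bij_inj inj]]]] x y xy|inj].
  have : Some x = Some y :> option F; last by case.
  by apply: inj; rewrite !(ratmapE _ _ _ red) /= xy.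
have [e [g [h red]]] := exists_reduced_form N_neq0 D_neq0.
exists e, g, h; split=> //; apply: injF_bij => x y.
rewrite !(ratmapE _ _ _ red); move: x y => [x|] [y|] //= [] /inj -> //.
Qed.

(** * Frobenius and the subfield *)

Lemma frobenius_rmorphism (F : finFieldType) p k : p \in [pchar F] ->
  exists s : {rmorphism F -> F}, forall x, s x = x ^+ (p ^ k).
Proof.
move=> pF; elim: k => [|k [s sE]]; first by exists idfun => x; rewrite expr1.
exists (GRing.pFrobenius_aut pF \o s : {rmorphism F -> F}) => x /=.
by rewrite sE pFrobenius_autE -exprM expnSr.
Qed.

(** The image under [iota] of ['X^#|K| - 'X] is the product of the
['X - (iota u)%:P]; evaluate it at [x]. *)
Lemma fixed_subfield (K F : finFieldType) (iota : {rmorphism K -> F}) (x : F) :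
  x ^+ #|K| = x -> exists u, x = iota u.
Proof.
move=> fx.
have := congr1 (fun P => (map_poly iota P).[x]) (finField_genPoly K).
rewrite /= rmorphB rmorph_prod /= map_polyXn map_polyX horner_prod !hornerE fx.
rewrite subrr.
move/esym/eqP/prodf_eq0 => [u _].
rewrite rmorphB /= map_polyX map_polyC !hornerE subr_eq0 => /eqP ->.
by exists u.
Qed.

Lemma card3_sqr1 (K : finFieldType) : 2 != 0 :> K ->
  (forall m : K, m != 0 -> m ^+ 2 = 1) <-> #|K| = 3%N.
Proof.
move=> two_neq0; split=> [sq1|K3 m m0]; last first.
  by apply: (mulfI m0); rewrite mulr1 -exprS -K3 expf_card.
have N1 : 1 != -1 :> K by rewrite -subr_eq0 opprK.
have /card_uniqP e : uniq [:: 0; 1; -1 : K].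
  by rewrite /= !inE negb_or eq_sym oner_neq0 eq_sym oppr_eq0 oner_neq0 N1.
rewrite -[RHS]e; apply: eq_card => m; rewrite !inE.
have [//|m0] := eqVneq m 0.
by rewrite -sqrf_eq1 sq1 ?eqxx.
Qed.

(** * The classification *)

Theorem proposition9 (p n q : nat) (p_prime : prime p) (n_gt0 : (0 < n)%N)
    (q_pn : q = (p ^ n)%N)
    (K F : finFieldType) (iota : {rmorphism K -> F})
    (cardK : #|K| = q) (cardF : #|F| = (q ^ 2)%N)
    (alpha beta a b c d : F) (d_notin_Fq : d \notin codom iota)
    (alphaE : alpha = - beta ^+ q) (alpha_neq0 : alpha != 0) :
  permutation_ratfun
    (tofrac (alpha *: 'X^(2 * q) + beta *: 'X^2 + a *: 'X^q + b *: 'X + c%:P)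
     / tofrac ('X^q + 'X + d%:P))
  <->
  [/\ q = 3%N,
      a ^+ q + b \notin codom iota,
      beta ^+ 2 = 1 /\ (b ^+ 2 - a ^+ 2 - beta * c) ^+ 2 = 1
    & beta * (a - b) - d = 0].
Proof.
have cardFp : #|F| = (p ^ (n * 2))%N by rewrite cardF q_pn expnM.
have [s] := frobenius_rmorphism n (card_finPcharP cardFp p_prime).
rewrite -q_pn => sE.
have s_iota u : s (iota u) = iota u by rewrite sE -rmorphXn -cardK expf_card.
have sK x : s (s x) = x by rewrite !sE -exprM mulnn -cardF expf_card.
have fix_s x : s x = x -> exists u, x = iota u.
  by rewrite sE -cardK; apply: fixed_subfield.
have q_gt1 : (1 < q)%N by rewrite -cardK finNzRing_gt1.
have cardF' : #|F| = (#|K| ^ 2)%N by rewrite cardK.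
have numE x :
    (alpha *: 'X^(2 * q) + beta *: 'X^2 + a *: 'X^q + b *: 'X + c%:P).[x]
    = beta * x ^+ 2 - s beta * s x ^+ 2 + a * s x + b * x + c.
  by rewrite !hornerE /= alphaE !sE mulnC exprM; ring.
have denE x : ('X^q + 'X + d%:P).[x] = s x + x + d by rewrite !hornerE /= sE.
rewrite permutation_ratfun_rootless; first last.
- by move=> x; rewrite denE (den_neq0 fix_s sK).
- set N := (X in (_ < size X)%N).
  have num_deg : (2 * q < size N)%N.
    rewrite ltnNge; apply: contraNN alpha_neq0 => /leq_sizeP /(_ _ (leqnn _)).
    rewrite /N !(coefD, coefZ, coefXn, coefX, coefC) eqxx.
    have [-> -> -> ->] : [/\ (2 * q == 2) = false, (2 * q == q) = false,
        (2 * q == 1) = false & (2 * q == 0) = false]%N by split; lia.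
    by rewrite !(mulr1, mulr0, addr0) => ->.
  apply: leq_ltn_trans num_deg.
  have : (size ('X^q + 'X + d%:P : {poly F})%R <= q.+1)%N.
    rewrite -addrA size_polyDl size_polyXn // ltnS.
    by rewrite size_XaddC.
  by move=> h; apply: leq_trans h _; lia.
have -> : injective (fun x =>
      (alpha *: 'X^(2 * q) + beta *: 'X^2 + a *: 'X^q + b *: 'X + c%:P).[x]
      / ('X^q + 'X + d%:P).[x])
    <-> injective (phi s beta a b c d).
  by split=> inj x y; have := inj x y; rewrite /phi !numE !denE.
rewrite -sE.
have [two0|two_neq0] := eqVneq (2 : K) 0.
  split=> [inj|[q3 _ _ _]].
    by case: (even_not_injective cardF' s_iota fix_s sK d_notin_Fq two0 inj).
  have := card_finPcharP (p := 3) (n := 1) (etrans cardK q3) isT.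
  rewrite inE /= => /eqP three0; case/negP: (oner_neq0 K); apply/eqP.
  by apply: (lincomb2 (c1 := 1) (c2 := -1) three0 two0); ring.
rewrite (odd_injectiveP cardF' s_iota fix_s sK beta a b c d_notin_Fq two_neq0).
have sq1 := card3_sqr1 two_neq0; rewrite cardK in sq1.
by split=> -[/sq1 ? ? ? ?].
Qed.
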